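(* Let $p$ be an odd prime. Then $$\sum_{k=1}^{p-1}\frac{\binom{2k}{k}}{k\,2^{k-1}}\equiv\sum_{k=1}^{p-1}\frac{\binom{2k}{k}}{k\,4^{k}}\equiv 2q_p(2)\pmod p.$$ If $p\neq3$, then $$\sum_{k=1}^{p-1}\frac{\binom{2k}{k}}{k\,3^{k-1}}\equiv3q_p(3)\pmod p.$$
   Context: For a prime $p$ and an integer $a$ not divisible by $p$, $q_p(a)$ denotes the integer $(a^{p-1}-1)/p$ (Fermat quotient). Congruences modulo $p$ between rational numbers are understood in the ring of rational numbers whose denominator is prime to $p$. *)

(* Defs.v *)
From mathcomp Require Import all_boot all_order all_algebra.

Set Implicit Arguments.
Unset Strict Implicit.
Unset Printing Implicit Defensive.

Import Order.TTheory GRing.Theory Num.Theory.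

Local Open Scope ring_scope.

Definition p_integral (p : nat) (x : rat) : bool := coprime p `|denq x|%N.

(* Congruence modulo p in the ring of p-integral rationals: both sides belong
   to this ring, and their difference to its ideal generated by p. *)
Definition rat_eqmod (p : nat) (x y : rat) : Prop :=
  [/\ p_integral p x, p_integral p y &
      exists2 z : rat, p_integral p z & x - y = p%:R * z].

(* Integer division; it is exact when p is prime and does not divide a. *)
Definition fermat_quotient (p : nat) (a : int) : int :=
  ((a ^+ p.-1 - 1) %/ p%:Z)%Z.

(* Main.v *)
(* Let W_n = a^n + b^n with a + b = 1 and a b = x.  Waring's formula gives
   W_p = 1 + p h, h = sum_(1 <= k < p) (-x)^k C(p-k,k) / (p-k), and termwise
   -2 h == sum_k C(2k,k) x^k / k (mod p).  For x = 1/m with m = 2, 3, 4, the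
   ratio a/b is a root of unity, so that W_n is periodic up to a factor and
   W_p^2 = m^(1-p) for p odd and prime to m.  Hence m^(p-1) (1 + p h)^2 = 1,
   and comparing with m^(p-1) = 1 + p q_p(m) yields -2 h == q_p(m) (mod p). *)
From HB Require Import structures.
Require Import Defs.
From mathcomp Require Import all_boot all_order all_algebra.
From mathcomp Require Import ring zify.

Set Implicit Arguments.
Unset Strict Implicit.
Unset Printing Implicit Defensive.

Import Order.TTheory GRing.Theory Num.Theory.

Local Open Scope ring_scope.

(** * The ring of rationals with denominator prime to [p] *)

(** The reduced denominator of [n / d] divides [d], by Gauss's lemma. *)
Lemma p_integral_frac (p : nat) (n d : int) :
  d != 0 -> coprime p `|d| -> p_integral p (n%:~R / d%:~R).
Proof.
move=> d0 cpd; rewrite /p_integral; set x := _ / _.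
have E : d * numq x = n * denq x.
  apply: (@intr_inj rat); rewrite !rmorphM /=.
  rewrite -[X in _ * X = _](divfK (_ : (denq x)%:~R != 0)) ?intr_eq0 ?denq_eq0 //.
  by rewrite divq_num_den {1}/x mulrA mulrCA mulfV ?intr_eq0 // mulr1.
apply: coprime_dvdr cpd.
rewrite -(@Gauss_dvdl _ _ `|numq x|); last by rewrite coprime_sym coprime_num_den.
by rewrite -abszM E abszM dvdn_mull.
Qed.

Lemma p_integral_subring (p : nat) : subring_closed (p_integral p).
Proof.
have dP x : (denq x)%:~R != 0 :> rat by rewrite intr_eq0 denq_eq0.
split=> [|x y|x y]; rewrite ?unfold_in ?inE.
- by rewrite /p_integral coprimen1.
- move=> px py.
  rewrite -[x]divq_num_den -[y]divq_num_den -mulNr addf_div //.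
  rewrite -!(rmorphN, rmorphM) -rmorphD.
  by apply: p_integral_frac; rewrite ?mulf_neq0 ?denq_eq0 // abszM coprimeMr px.
- move=> px py.
  rewrite -[x]divq_num_den -[y]divq_num_den mulf_div -!rmorphM.
  by apply: p_integral_frac; rewrite ?mulf_neq0 ?denq_eq0 // abszM coprimeMr px.
Qed.

HB.instance Definition _ p :=
  GRing.isSubringClosed.Build rat (p_integral p) (p_integral_subring p).

Lemma p_integralV_nat (p n : nat) :
  (0 < n)%N -> coprime p n -> n%:R^-1 \in p_integral p.
Proof.
move=> n0 cpn; rewrite -[_^-1]div1r.
by apply: (@p_integral_frac p 1 n%:Z) => //; rewrite -lt0n.
Qed.

(** * Calculus of congruences between [p]-integral rationals *)

Section Congruence.

Variable p : nat.

Lemma eqmod_intro x y z : x \in p_integral p -> y \in p_integral p ->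
  z \in p_integral p -> x - y = p%:R * z -> rat_eqmod p x y.
Proof. by move=> px py pz E; split=> //; exists z. Qed.

Lemma eqmod_refl x : x \in p_integral p -> rat_eqmod p x x.
Proof.
by move=> px; apply: (@eqmod_intro _ _ 0); rewrite ?rpred0 // subrr mulr0.
Qed.

Lemma eqmod_sym x y : rat_eqmod p x y -> rat_eqmod p y x.
Proof.
by case=> px py [z pz E]; apply: (@eqmod_intro _ _ (- z));
  rewrite ?rpredN // mulrN -E opprB.
Qed.

Lemma eqmod_trans y x z : rat_eqmod p x y -> rat_eqmod p y z -> rat_eqmod p x z.
Proof.
case=> px py [u pu E] [_ pz [v pv F]]; apply: (@eqmod_intro _ _ (u + v)) => //.
  exact: rpredD.
by rewrite mulrDr -E -F addrA subrK.
Qed.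

Lemma eqmodD x y x' y' :
  rat_eqmod p x y -> rat_eqmod p x' y' -> rat_eqmod p (x + x') (y + y').
Proof.
case=> px py [u pu E] [px' py' [v pv F]].
apply: (@eqmod_intro _ _ (u + v)); rewrite ?rpredD //.
by rewrite mulrDr -E -F; ring.
Qed.

Lemma eqmodM x y x' y' :
  rat_eqmod p x y -> rat_eqmod p x' y' -> rat_eqmod p (x * x') (y * y').
Proof.
case=> px py [u pu E] [px' py' [v pv F]].
apply: (@eqmod_intro _ _ (u * x' + y * v)); rewrite ?(rpredD, rpredM) //.
by rewrite mulrDr mulrA -E mulrCA -F; ring.
Qed.

Lemma eqmod_sum (I : eqType) (r : seq I) (F G : I -> rat) :
  (forall i, i \in r -> rat_eqmod p (F i) (G i)) ->
  rat_eqmod p (\sum_(i <- r) F i) (\sum_(i <- r) G i).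
Proof.
move=> FG; rewrite !big_seq; apply: (big_ind2 (rat_eqmod p)) => //.
  by apply: eqmod_refl; rewrite rpred0.
by move=> *; apply: eqmodD.
Qed.

Lemma eqmod_prod (I : eqType) (r : seq I) (F G : I -> rat) :
  (forall i, i \in r -> rat_eqmod p (F i) (G i)) ->
  rat_eqmod p (\prod_(i <- r) F i) (\prod_(i <- r) G i).
Proof.
move=> FG; rewrite !big_seq; apply: (big_ind2 (rat_eqmod p)) => //.
  by apply: eqmod_refl; rewrite rpred1.
by move=> *; apply: eqmodM.
Qed.

Lemma eqmod_mul2l (n : nat) x y : (0 < n)%N -> coprime p n ->
  rat_eqmod p (n%:R * x) (n%:R * y) -> rat_eqmod p x y.
Proof.
move=> n0 cpn E.
have n0' : n%:R != 0 :> rat by rewrite pnatr_eq0 -lt0n.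
rewrite -[x](mulKf n0') -[y](mulKf n0'); apply: eqmodM E.
exact/eqmod_refl/p_integralV_nat.
Qed.

End Congruence.

(** * Falling factorials and Lucas sequences *)

(** Turns a binomial coefficient into a product that can be compared factor by factor modulo [p].
    For [n < k] both sides vanish, the right one through its factor [i = n]. *)
Lemma bin_fact_prod (R : comNzRingType) (n k : nat) :
  k`!%:R * 'C(n, k)%:R = \prod_(0 <= i < k) (n%:R - i%:R) :> R.
Proof.
rewrite -natrM mulnC bin_ffact; elim: k => [|k IH]; first by rewrite big_geq.
rewrite big_nat_recr //= -IH ffactnSr natrM.
have [nk|kn] := ltnP n k; first by rewrite ffact_small // !mul0r.
by rewrite natrB.
Qed.

(** Closed form of [(a^(j+1) - b^(j+1)) / (a - b)], where [a + b = 1] and [a b = x]; the terms with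
    [2k > j] are zero. *)
Definition fib_poly (R : comNzRingType) (x : R) (j : nat) : R :=
  \sum_(k < j.+1) 'C(j - k, k)%:R * (- x) ^+ k.

Lemma fib_polyE (R : comNzRingType) (x : R) j N : (j < N)%N ->
  fib_poly x j = \sum_(k < N) 'C(j - k, k)%:R * (- x) ^+ k.
Proof.
move=> jN; rewrite /fib_poly.
rewrite -(big_mkord xpredT (fun k => 'C(j - k, k)%:R * (- x) ^+ k)).
rewrite -(big_mkord xpredT (fun k => 'C(j - k, k)%:R * (- x) ^+ k)).
rewrite [RHS](@big_cat_nat _ _ _ j.+1) //=.
rewrite [X in _ = _ + X]big_nat [X in _ + X]big1 ?addr0 // => k /andP[jk _].
by rewrite bin_small ?mul0r //; lia.
Qed.

(** Pascal's rule applied termwise, after peeling off the term [k = 0] and the zero term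
    [k = j + 2]. *)
Lemma fib_polySS (R : comNzRingType) (x : R) j :
  fib_poly x j.+2 = fib_poly x j.+1 - x * fib_poly x j.
Proof.
rewrite (@fib_polyE _ _ j.+1 j.+2) // /fib_poly big_ord_recl big_ord_recr.
rewrite [X in _ = X - _]big_ord_recl /= !subn0 !bin0 /bump /= !add1n.
rewrite subSS subnn bin0n mul0r addr0 -addrA; congr (_ + _).
rewrite mulr_sumr -sumrB; apply: eq_bigr => k _.
rewrite !add1n !subSS subSn; last by rewrite -ltnS.
rewrite binS natrD exprS; ring.
Qed.

(* Index shift: lucas x j = a^(j+1) + b^(j+1), where a + b = 1 and a * b = x. *)
Definition lucas (R : comNzRingType) (x : R) (j : nat) : R :=
  2 * fib_poly x j.+1 - fib_poly x j.

Lemma lucas0 (R : comNzRingType) (x : R) : lucas x 0 = 1.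
Proof.
rewrite /lucas /fib_poly !big_ord_recl !big_ord0 /= !bin0 !expr0 mul0r.
ring.
Qed.

Lemma lucas1 (R : comNzRingType) (x : R) : lucas x 1 = 1 - 2 * x.
Proof.
rewrite /lucas fib_polySS /fib_poly !big_ord_recl !big_ord0 /= !bin0 !expr0 mul0r.
ring.
Qed.

Lemma lucasSS (R : comNzRingType) (x : R) j :
  lucas x j.+2 = lucas x j.+1 - x * lucas x j.
Proof. by rewrite /lucas !fib_polySS; ring. Qed.

(** Here [a = b = 1/2]. *)
Lemma lucas_quarter (F : numFieldType) j : lucas (4^-1 : F) j = 2^-1 ^+ j.
Proof.
suff: lucas (4^-1 : F) j = 2^-1 ^+ j /\
      lucas (4^-1 : F) j.+1 = 2^-1 ^+ j.+1 by case.
elim: j => [|j [IH IH1]]; first by rewrite lucas0 lucas1; split=> //; field.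
by split=> //; rewrite lucasSS IH IH1 !exprS; field.
Qed.

(** Here [a, b = (1 ± i)/2], so [a^4 = b^4 = -1/4]: a shift by 4 multiplies the sequence by [-1/4].
    Even indices are odd exponents. *)
Lemma lucas_half (F : numFieldType) n :
  lucas (2^-1 : F) n.*2 ^+ 2 = 2^-1 ^+ n.*2.
Proof.
have P j : lucas (2^-1 : F) (j.+4) = - 4^-1 * lucas 2^-1 j.
  by rewrite !lucasSS; field.
elim/ltn_ind: n => -[|[|n]] IH; first by rewrite lucas0 expr1n.
  by rewrite /= lucasSS lucas0 lucas1; field.
by rewrite !doubleS P exprMn IH // !exprS; field.
Qed.

(** Here [a] and [b] are [exp(± i pi/6) / sqrt 3], so [a^6 = b^6 = -1/27]. At odd multiples of 3 the
    sum [a^n + b^n] is zero, whence the hypothesis on the exponent [n.*2.+1]. *)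
Lemma lucas_third (F : numFieldType) n : ~~ (3 %| n.*2.+1)%N ->
  lucas (3^-1 : F) n.*2 ^+ 2 = 3^-1 ^+ n.*2.
Proof.
have P j : lucas (3^-1 : F) (j.+4.+2) = - 27^-1 * lucas 3^-1 j.
  by rewrite !lucasSS; field.
elim/ltn_ind: n => -[|[|[|n]]] IH; first by rewrite lucas0 expr1n.
- by case/negP.
- by move=> _; rewrite !lucasSS lucas0 lucas1; field.
rewrite !doubleS => nz; rewrite P exprMn IH //; first by rewrite !exprS; field.
by rewrite ltnS -addn2 leq_addr.
Qed.

(** Termwise, [2 C(p-k,k) - C(p-1-k,k) = p C(p-k,k) / (p-k)], because
    [(p-k) C(p-1-k,k) = (p-2k) C(p-k,k)]; the term [k = 0] gives the 1. *)
Lemma lucas_waring (F : numFieldType) (p : nat) (x : F) : (0 < p)%N ->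
  lucas x p.-1 = 1 + p%:R *
    \sum_(1 <= k < p) 'C(p - k, k)%:R / (p - k)%:R * (- x) ^+ k.
Proof.
case: p => // p _; rewrite /lucas (@fib_polyE _ _ _ p.+2) // big_ord_recr /=.
rewrite subnn bin0n mul0r addr0 /fib_poly !big_ord_recl /= !subn0 !bin0 expr0.
rewrite big_add1 big_mkord mulr_sumr mulrDr [in LHS]mulr_sumr !mulr1.
rewrite opprD addrACA -sumrB; congr (_ + _); first by ring.
apply: eq_bigr => k _; rewrite /bump /= !add1n subSS.
have [c kc] : exists c, (p - k = c.+1)%N.
  by exists (p - k).-1; rewrite prednK // subn_gt0.
have pE : p.+1%:R = k.+1%:R + c.+1%:R :> F.
  by rewrite -natrD -kc addSn subnKC // ltnW.
have -> : (p - k.+1 = c)%N by rewrite subnS kc.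
rewrite kc.
have := mul_bin_down c.+1 k.+1; rewrite /=.
have [kc1|ck] := leqP k.+1 c.+1; last first.
  by rewrite (bin_small ck) (bin_small (ltnW ck)) mulr0n !(mul0r, mulr0) subrr.
move/(congr1 (fun n => n%:R : F)); rewrite !natrM natrB // => E.
have c0 : c.+1%:R != 0 :> F by rewrite pnatr_eq0.
apply: (mulfI c0).
rewrite mulrBr [c.+1%:R * (_ * (- x) ^+ _)]mulrA E pE.
move: (c.+1%:R) (k.+1%:R) c0 => C K C0.
by field.
Qed.

(** * Congruences modulo a prime *)

Section PrimeModulus.

Variable p : nat.
Hypothesis p_prime : prime p.

Lemma coprime_lt_prime k : (0 < k < p)%N -> coprime p k.
Proof.
by case/andP=> k0 kp; rewrite prime_coprime // gtnNdvd.
Qed.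

(** After multiplication by [k!], invertible modulo [p], the factors [p - k - i] on the left are
    congruent to [-(k + i)], and the product of the [k + i] for [i < k] is [k! C(2k-1,k)]. *)
Lemma bin_eqmod k : (0 < k < p)%N ->
  rat_eqmod p (2 * 'C(p - k, k)%:R) ((-1) ^+ k * 'C(2 * k, k)%:R).
Proof.
move=> kp; have [k0 ltkp] := andP kp.
have cpf : coprime p k`!.
  rewrite fact_prod big_nat; elim/big_ind: _ => [||i /andP[i0 ik]].
  - exact: coprimen1.
  - by move=> a b pa pb; rewrite coprimeMr pa.
  - by rewrite coprime_lt_prime // i0 (leq_trans _ ltkp).
apply: (eqmod_mul2l (fact_gt0 k) cpf).
(* Halving [C(2k,k)] makes its factors run over [k, ..., 2k-1]; reversing the product then aligns
   them with the other side. *)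
have -> : 'C(2 * k, k) = (2 * 'C((2 * k).-1, k))%N.
  apply/eqP; rewrite -(eqn_pmul2l k0) mulnA [(k * 2)%N]mulnC mul_bin_down.
  by rewrite mul2n -addnn addnK.
rewrite natrM !(mulrCA _ 2); apply: eqmodM.
  by apply: eqmod_refl; rewrite rpred_nat.
rewrite mulrCA !bin_fact_prod [X in _ * X]big_nat_rev /=.
rewrite -[(-1) ^+ k](_ : \prod_(0 <= i < k) -1 = _); last first.
  by rewrite prodr_const_nat subn0.
rewrite -big_split; apply: eqmod_prod => i; rewrite mem_index_iota /= => ik.
have -> : (2 * k).-1%:R - (0 + k - i.+1)%:R = k%:R + i%:R :> rat.
  by rewrite -natrB -?natrD; [congr _%:R|]; lia.
(* The difference [(p - k - i) + (k + i)] is exactly [p]. *)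
apply: (@eqmod_intro _ _ _ 1);
  rewrite ?(rpredB, rpredM, rpredD, rpredN, rpred1, rpred_nat) //.
by rewrite natrB ?(ltnW ltkp) //; ring.
Qed.

Lemma waring_coef_eqmod k : (0 < k < p)%N ->
  rat_eqmod p (- 2 * ('C(p - k, k)%:R / (p - k)%:R) * (-1) ^+ k)
    ('C(2 * k, k)%:R / k%:R).
Proof.
move=> kp; have [k0 ltkp] := andP kp.
have pk : (0 < p - k < p)%N by rewrite subn_gt0 ltkp ltn_subrL k0 prime_gt0.
have k0' : k%:R != 0 :> rat by rewrite pnatr_eq0 -lt0n.
have pk0 : (p - k)%:R != 0 :> rat by rewrite pnatr_eq0 -lt0n; case/andP: pk.
have kI : k%:R^-1 \in p_integral p.
  by apply: p_integralV_nat (coprime_lt_prime _).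
have pkI : (p - k)%:R^-1 \in p_integral p.
  by apply: p_integralV_nat; [case/andP: pk | exact: coprime_lt_prime].
(* This is [p - k == -k] inverted; the sign is carried along to cancel the one in [bin_eqmod]. *)
have inv : rat_eqmod p (- (-1) ^+ k / (p - k)%:R) ((-1) ^+ k / k%:R).
  apply: (@eqmod_intro _ _ _ (- (-1) ^+ k / (p - k)%:R / k%:R)).
  - by rewrite rpredM ?rpredN ?rpredX ?rpredN ?rpred1.
  - by rewrite rpredM ?rpredX ?rpredN ?rpred1.
  - by rewrite !rpredM ?rpredN ?rpredX ?rpredN ?rpred1.
  move: pk0; rewrite natrB 1?ltnW // => pk0.
  move: (p%:R : rat) (k%:R : rat) ((-1) ^+ k : rat) pk0 k0' => P K s PK K0.
  by field; rewrite ?PK ?K0.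
have := eqmodM (bin_eqmod kp) inv.
have s2 : (-1) ^+ k * (-1) ^+ k = 1 :> rat.
  by rewrite -exprD addnn -signr_odd odd_double.
congr (rat_eqmod p _ _); first by ring.
by rewrite mulrACA s2 mul1r.
Qed.

(** Exactness of the division: Fermat's [a^p == a] with the factor [a] cancelled. *)
Lemma fermat_quotientE (a : nat) : coprime p a ->
  p%:R * (fermat_quotient p a)%:~R = a%:R ^+ p.-1 - 1 :> rat.
Proof.
move=> cpa.
have /dvdzP[q E] : (p %| a%:Z ^+ p.-1 - 1)%Z.
  have pa : (0 < a)%N.
    case: a cpa => //; rewrite /coprime gcdn0 => /eqP p1.
    by move: p_prime; rewrite p1.
  rewrite -(@Gauss_dvdzr _ a%:Z (a%:Z ^+ p.-1 - 1)) // mulrBr mulr1 -exprS.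
  rewrite prednK ?prime_gt0 //.
  rewrite -eqz_mod_dvd -rmorphXn /= !modz_nat eqz_nat natrXE.
  exact/eqP/fermat_little.
have p0 : p%:Z != 0 by rewrite -lt0n prime_gt0.
rewrite /fermat_quotient E mulzK // -[p%:R]/(p%:Z%:~R) -intrM mulrC -E.
by rewrite rmorphB rmorphXn.
Qed.

(** Common core of the cases [m = 2, 3, 4], which differ only in how the hypothesis on [lucas] is
    met. *)
Lemma central_binomial_sum_eqmod (m : nat) : (0 < m)%N -> coprime p m ->
  lucas (m%:R^-1 : rat) p.-1 ^+ 2 = m%:R^-1 ^+ p.-1 ->
  rat_eqmod p (\sum_(1 <= k < p) 'C(2 * k, k)%:R / (k%:R * m%:R ^+ k))
    (fermat_quotient p m)%:~R.
Proof.
move=> m0 cpm; rewrite lucas_waring ?prime_gt0 //; set h := \sum_(_ <= _ < _) _.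
have m0' : m%:R != 0 :> rat by rewrite pnatr_eq0 -lt0n.
have p0' : p%:R != 0 :> rat by rewrite pnatr_eq0 -lt0n prime_gt0.
have mI := p_integralV_nat m0 cpm.
have hI : h \in p_integral p.
  rewrite /h big_nat rpred_sum // => k /andP[k0 kp].
  rewrite !rpredM ?rpredX ?rpredN ?rpred_nat //.
  apply: p_integralV_nat; rewrite ?subn_gt0 // coprime_lt_prime //.
  by rewrite subn_gt0 kp ltn_subrL k0 prime_gt0.
have := fermat_quotientE cpm; set q := _%:~R => qE hE.
have qI : q \in p_integral p by rewrite rpred_int.
apply: (@eqmod_trans _ (- 2 * h)).
  rewrite /h mulr_sumr; apply: eqmod_sum => k.
  rewrite mem_index_iota => kp.
  have := eqmodM (eqmod_sym (waring_coef_eqmod kp)) (eqmod_refl (rpredX k mI)).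
  congr (rat_eqmod p _ _); first by rewrite exprVn invfM mulrA.
  by rewrite -[- m%:R^-1]mulN1r exprMn; ring.
(* The witness comes from expanding [(1 + p q) (1 + p h)^2 = 1], dividing by [p] and isolating
   [-2 h - q]. *)
apply: (@eqmod_intro _ _ _ (2 * q * h + q * p%:R * h ^+ 2 + h ^+ 2)) => //.
- by rewrite rpredM ?rpredN ?rpred_nat.
- by rewrite !rpredD ?rpredM ?rpredX ?rpred_nat.
apply: (mulfI p0').
have {}hE : (1 + p%:R * q) * (1 + p%:R * h) ^+ 2 = 1.
  by rewrite qE addrC subrK hE exprVn mulfV ?expf_neq0.
apply: subr0_eq; apply: etrans (_ : 1 - (1 + p%:R * q) * (1 + p%:R * h) ^+ 2 = 0).
  by ring.
by rewrite hE subrr.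
Qed.

End PrimeModulus.

Theorem corollary1p2 (p : nat) (p_prime : prime p) (p_odd : odd p) :
  [/\ rat_eqmod p
        (\sum_(1 <= k < p) 'C(2 * k, k)%:R / (k%:R * 2 ^+ k.-1))
        (\sum_(1 <= k < p) 'C(2 * k, k)%:R / (k%:R * 4 ^+ k)),
      rat_eqmod p
        (\sum_(1 <= k < p) 'C(2 * k, k)%:R / (k%:R * 4 ^+ k))
        (2 * (fermat_quotient p 2)%:~R)
    & p != 3%N ->
      rat_eqmod p
        (\sum_(1 <= k < p) 'C(2 * k, k)%:R / (k%:R * 3 ^+ k.-1))
        (3 * (fermat_quotient p 3)%:~R)].
Proof.
have pE : p.-1 = (p.-1)./2.*2
  by rewrite even_halfK // -subn1 oddB ?prime_gt0 ?p_odd.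
have p0 : p%:R != 0 :> rat by rewrite pnatr_eq0 -lt0n prime_gt0.
have cp2 : coprime p 2 by rewrite coprimen2.
have cp4 : coprime p 4 by rewrite -[4%N]/(2 * 2)%N coprimeMr cp2.
(* The exponent [k.-1] costs one factor [m], as [k] starts at 1. *)
have shift (m : nat) : (0 < m)%N ->
    \sum_(1 <= k < p) 'C(2 * k, k)%:R / (k%:R * m%:R ^+ k.-1) =
    m%:R * \sum_(1 <= k < p) 'C(2 * k, k)%:R / (k%:R * m%:R ^+ k) :> rat.
  move=> m0; rewrite mulr_sumr !big_nat; apply: eq_bigr => -[//|k] _ /=.
  have m0' : m%:R != 0 :> rat by rewrite pnatr_eq0 -lt0n.
  by rewrite [RHS]mulrCA exprS (mulrCA k.+1%:R) [in RHS]invfM mulVKf.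
have S2 : rat_eqmod p (\sum_(1 <= k < p) 'C(2 * k, k)%:R / (k%:R * 2 ^+ k))
    (fermat_quotient p 2)%:~R.
  by apply: central_binomial_sum_eqmod => //; rewrite pE lucas_half.
(* Squaring [2^(p-1) = 1 + p q] gives [4^(p-1) - 1 = p (2 q + p q^2)], hence the witness [q^2]. *)
have q4 : rat_eqmod p (fermat_quotient p 4)%:~R (2 * (fermat_quotient p 2)%:~R).
  have E2 := fermat_quotientE p_prime cp2.
  have E4 := fermat_quotientE p_prime cp4.
  apply: (@eqmod_intro _ _ _ ((fermat_quotient p 2)%:~R ^+ 2)).
  - by rewrite rpred_int.
  - by rewrite rpredM ?rpred_nat ?rpred_int.
  - by rewrite rpredX ?rpred_int.
  apply: (mulfI p0); rewrite [RHS]mulrA -expr2 -exprMn mulrBr E4 mulrCA E2.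
  by rewrite [4%:R](natrM _ 2 2) exprMn; move: (_ ^+ _) => u; ring.
have S4 : rat_eqmod p (\sum_(1 <= k < p) 'C(2 * k, k)%:R / (k%:R * 4 ^+ k))
    (2 * (fermat_quotient p 2)%:~R).
  apply: eqmod_trans q4; apply: central_binomial_sum_eqmod => //.
  by rewrite lucas_quarter -exprM mulnC exprM exprVn -natrX.
split=> // [|p3].
- rewrite (shift 2%N) //; apply: eqmod_trans (eqmod_sym S4).
  by apply: eqmodM S2; apply: eqmod_refl; rewrite rpred_nat.
rewrite (shift 3%N) //; apply: eqmodM.
  by apply: eqmod_refl; rewrite rpred_nat.
(* Required by [lucas_third], whose exponent is [p] itself. *)
have np3 : ~~ (3 %| p)%N by rewrite dvdn_prime2 // eq_sym.
apply: central_binomial_sum_eqmod; rewrite // ?prime_coprime //.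
  by rewrite dvdn_prime2.
by rewrite pE lucas_third // -pE prednK ?prime_gt0.
Qed.
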